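(* Let $\mathbb{F}$ be a field with $\mathrm{char}(\mathbb{F})\notin\{2,3\}$, let $S_3$ be the symmetric group of degree $3$ and $C_3$ the cyclic group of order $3$. Then $\beta(S_3\times C_3)=8$.
   Context: For a finite group $G$, a $G$-module is a finite dimensional $\mathbb{F}$-vector space $V$ with a linear action of $G$. $S(V)$ is the symmetric algebra of $V$ (a polynomial algebra on a basis of $V$, with each variable of degree one), on which $G$ acts by $\mathbb{F}$-algebra automorphisms extending the action on $V$, and $S(V)^G$ is the subalgebra of $G$-invariants. $\beta(S(V)^G)$ is the minimal non-negative integer $d$ such that the $\mathbb{F}$-algebra $S(V)^G$ is generated by its homogeneous components of degree at most $d$. The Noether number is $\beta(G)=\sup\{\beta(S(V)^G): V \text{ is a } G\text{-module over }\mathbb{F}\}$. *)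

(* Defs.v *)
From HB Require Import structures.
From mathcomp Require Import all_boot all_order all_algebra all_fingroup.
From mathcomp Require Import mxrepresentation.
From mathcomp Require Export mpoly.

Set Implicit Arguments.
Unset Strict Implicit.
Unset Printing Implicit Defensive.

Import GRing.Theory.

Local Open Scope ring_scope.

(* The subalgebra of A generated by the subset S. *)
Inductive generated_alg (K : fieldType) (A : algType K) (S : A -> Prop) :
    A -> Prop :=
| GenIn x : S x -> generated_alg S x
| GenScalar (c : K) : generated_alg S c%:A
| GenAdd x y :
    generated_alg S x -> generated_alg S y -> generated_alg S (x + y)
| GenMul x y :
    generated_alg S x -> generated_alg S y -> generated_alg S (x * y).

Section Invariants.

Variables (F : fieldType) (gT : finGroupType) (G : {group gT}) (n : nat).
Variable rG : mx_representation F G n.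

(* A G-module V with a chosen basis e_0, ..., e_(n-1) is given by rG, where g   *)
(* acts on row vectors by v |-> v *m rG g, and S(V) is {mpoly F[n]} with        *)
(* 'X_i = e_i.  So g maps 'X_i to the linear form given by row i of rG g.       *)
(* This is the MathComp convention, a right action; the corresponding left      *)
(* action (by g^-1) has the same invariants.                                    *)
Definition sym_act (g : gT) (p : {mpoly F[n]}) : {mpoly F[n]} :=
  p \mPo [tuple \sum_(j < n) rG g i j *: 'X_j | i < n].

Definition invariant (p : {mpoly F[n]}) : Prop :=
  forall g, g \in G -> sym_act g p = p.

Definition generated_in_degree_le (d : nat) : Prop :=
  forall p, invariant p ->
    generated_alg
      (fun q => invariant q /\ exists2 k, (k <= d)%N & q \is k.-homog) p.

(* beta(S(V)^G) = d *)
Definition is_beta (d : nat) : Prop :=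
  generated_in_degree_le d /\
  forall d', generated_in_degree_le d' -> (d <= d')%N.

End Invariants.

(* d is an upper bound of the numbers beta(S(V)^G); in particular all of them   *)
(* are finite.                                                                  *)
Definition beta_bounded_by (F : fieldType) (gT : finGroupType) (G : {group gT})
    (d : nat) : Prop :=
  forall (n : nat) (rG : mx_representation F G n),
    exists2 b, is_beta rG b & (b <= d)%N.

(* beta(G) = d, as the least upper bound over all G-modules V over F. *)
Definition is_noether_number (F : fieldType) (gT : finGroupType)
    (G : {group gT}) (d : nat) : Prop :=
  beta_bounded_by F G d /\
  forall d', beta_bounded_by F G d' -> (d <= d')%N.

(* Main.v *)
Require Import Defs.
From HB Require Import structures.
From Stdlib Require Import Classical.
From mathcomp Require Import all_boot all_order all_algebra all_fingroup all_field.
From mathcomp Require Import mxrepresentation.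
From mathcomp Require Import ring zify.

(** Let A be the normal subgroup of index two isomorphic to C_3 x C_3, generated
    by a rotation of S_3 and by the factor C_3, and let t be a transposition.
    Let w be a primitive cube root of unity; it is available after passing to an
    extension K of F, and K is only used as an auxiliary tool.

    Upper bound. Write R for the algebra of A-invariants.  Over K every linear
    form is a sum of simultaneous eigenvectors of A, so R is spanned by the
    products of eigenvectors whose weights form a zero-sum sequence over Z/3 x
    Z/3.  Such a sequence of length at least 9 splits into three nonempty
    zero-sum sequences ([zero_sum_split3]): a short one, of length at most 3, is
    found among any 7 terms, and what remains has at least 6 terms, any 5 of which
    contain a second one.  Hence a homogeneous element of R of degree at least 9
    is a sum of products of three elements of R of positive degree
    ([fixed_triple_products], and [fixed_triple_products_descent] over F).  Now
    split each of the three factors into its t-symmetric and t-antisymmetric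
    parts: in the symmetric part of the product the antisymmetric parts occur in
    pairs, so that it is a sum of products of G-invariants of smaller degree
    ([transfer_triple]).  By induction everything is generated in degree at most 8.

    Lower bound. Let K[x, y, z] carry the action in which the rotation multiplies
    x, y by w, w^2, the factor C_3 multiplies x, y, z by w, w, w^2, and t exchanges
    x and y and changes the sign of z.  The invariant x^5 y^2 z - x^2 y^5 z has
    degree 8, and it is indecomposable: the only way to split x^5 y^2 z into two
    A-invariant monomials is x^3 times x^2 y^2 z, and the coefficient of
    x^2 y^2 z in an invariant vanishes because t maps this monomial to its opposite
    ([mcoeff521_mul]).  To obtain a representation over F, the argument is pulled
    back along the equivariant morphism [eval_forms] from the symmetric algebra
    of the regular representation over F, and an invariant whose image has a
    nonzero coefficient at x^5 y^2 z is produced by summing over the group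
    ([regular_degree_lower_bound]). *)

Set Implicit Arguments.
Unset Strict Implicit.
Unset Printing Implicit Defensive.

Import GRing.Theory.

(** * Zero-sum sequences over Z/3 x Z/3 *)

(** Weights are pairs of arbitrary natural numbers, read modulo 3: they are the
    exponents of the cube root of unity in eigenvalue equations, and no
    normalization is then needed when eigenvectors are multiplied. *)
Definition zero_sum (w : seq (nat * nat)) :=
  (3 %| sumn (unzip1 w)) && (3 %| sumn (unzip2 w)).

Fixpoint subsequences (T : Type) (s : seq T) : seq (seq T) :=
  if s is x :: s' then
    let r := subsequences s' in map (cons x) r ++ r else [:: [::]].

Definition has_short_zero_sum k w :=
  has (fun u => (0 < size u <= k) && zero_sum u) (subsequences w).

Definition residues := [seq (i, j) | i <- iota 0 3, j <- iota 0 3].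

(** A search through the multisets obtained from [w] by adding [n] residues of
    the list [rs]; a branch is abandoned once its multiset contains a zero-sum
    subsequence with between 1 and [k] terms.  Taking the residues in the order of
    [rs] visits each multiset once, which keeps the search small enough to be
    evaluated. *)
Fixpoint short_zero_sum_forced k n : seq (nat * nat) -> seq (nat * nat) -> bool :=
  if n is n'.+1 then
    fix branch rs w :=
      has_short_zero_sum k w ||
      (if rs is r :: rs' then
         short_zero_sum_forced k n' rs (r :: w) && branch rs' w
       else true)
  else fun rs w => has_short_zero_sum k w.

Lemma mem_subsequences (T : eqType) (s u : seq T) :
  u \in subsequences s -> exists v, perm_eq (u ++ v) s.
Proof.
elim: s u => [|x s IHs] u /=; first by rewrite inE => /eqP ->; exists [::].
rewrite mem_cat => /orP[/mapP[u' /IHs[v uv] ->] | /IHs[v uv]].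
  by exists v; rewrite /= perm_cons.
by exists (x :: v); rewrite perm_catC /= perm_cons perm_catC.
Qed.

Lemma subsequences_map (T1 T2 : Type) (g : T1 -> T2) s :
  subsequences (map g s) = map (map g) (subsequences s).
Proof. by elim: s => //= x s ->; rewrite map_cat -!map_comp. Qed.

Lemma sumn_mod3 (s : seq nat) : (3 %| sumn (map (modn^~ 3) s)) = (3 %| sumn s).
Proof.
rewrite /dvdn; congr (_ == _); elim: s => //= x s IHs.
by rewrite -modnDm IHs modn_mod modnDm.
Qed.

Definition reduce (x : nat * nat) := (x.1 %% 3, x.2 %% 3).

Lemma zero_sum_reduce w : zero_sum (map reduce w) = zero_sum w.
Proof.
rewrite /zero_sum /unzip1 /unzip2 -!map_comp.
rewrite -[in RHS](sumn_mod3 (map fst w)) -[in RHS](sumn_mod3 (map snd w)).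
by rewrite -!map_comp.
Qed.

Lemma reduce_residues x : reduce x \in residues.
Proof. by apply/allpairsP; exists (reduce x); rewrite !mem_iota !ltn_pmod. Qed.

Lemma zero_sum_perm w1 w2 : perm_eq w1 w2 -> zero_sum w1 = zero_sum w2.
Proof.
move=> eqw; rewrite /zero_sum.
by rewrite (perm_sumn (perm_map fst eqw)) (perm_sumn (perm_map snd eqw)).
Qed.

Lemma zero_sum_cat w1 w2 : zero_sum w1 -> zero_sum (w1 ++ w2) = zero_sum w2.
Proof.
rewrite /zero_sum /unzip1 /unzip2 !map_cat !sumn_cat => /andP[d1 d2].
by rewrite !dvdn_addr.
Qed.

Section Extract.
Variables (T : eqType) (f : T -> nat * nat) (k : nat).
Let g := reduce \o f.

Lemma has_short_zero_sumP (w : seq T) : has_short_zero_sum k (map g w) ->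
  exists s1 s2, [/\ perm_eq (s1 ++ s2) w, 0 < size s1 <= k & zero_sum (map f s1)].
Proof.
rewrite /has_short_zero_sum subsequences_map.
case/hasP=> _ /mapP[s1 /mem_subsequences[s2 sw] ->] /andP[sz z1].
exists s1, s2; split=> //; first by rewrite size_map in sz.
by rewrite -zero_sum_reduce -map_comp.
Qed.

(** Correctness of the search: if the first residue of [rs] is the weight of some
    term of [t], this term is moved to [w]; otherwise the residue is dropped. *)
Lemma short_zero_sum_forcedP n rs (w t : seq T) :
    short_zero_sum_forced k n rs (map g w) -> size t = n ->
    all (fun x => g x \in rs) t ->
  exists s1 s2, [/\ perm_eq (s1 ++ s2) (t ++ w), 0 < size s1 <= k
                  & zero_sum (map f s1)].
Proof.
have hit (t' w' : seq T) : has_short_zero_sum k (map g w') ->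
    exists s1 s2, [/\ perm_eq (s1 ++ s2) (t' ++ w'), 0 < size s1 <= k
                    & zero_sum (map f s1)].
  case/has_short_zero_sumP=> s1 [s2 [eqs sz z1]]; exists s1, (s2 ++ t').
  by rewrite catA perm_catC perm_cat2l.
elim: n rs w t => [|n IHn] rs w t; first by move=> /hit.
elim: rs => [|r rs IHrs] /orP[/hit // | search] szt.
  by case: t szt.
case: (boolP (has (fun x => g x == r) t)) => [/hasP[x xt /eqP gx] tr | nor tr].
  have eqt := perm_to_rem xt.
  have [|||s1 [s2 [eqs sz z1]]] := IHn (r :: rs) (x :: w) (rem x t).
  - by rewrite /= gx; case/andP: search.
  - by rewrite size_rem // szt.
  - by rewrite (perm_all _ eqt) /= in tr; case/andP: tr.
  exists s1, s2; split=> //; rewrite (permPl eqs) -cat1s catA perm_cat2r.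
  by rewrite perm_catC perm_sym.
case/andP: search => _ search; apply: IHrs search szt _.
apply/allP=> x xt; move/allP/(_ x xt): tr; rewrite inE => /orP[gx|//].
by case/hasP: nor; exists x.
Qed.

Lemma extract_short_zero_sum n (s : seq T) :
    short_zero_sum_forced k n residues [::] -> n <= size s ->
  exists s1 s2, [/\ perm_eq (s1 ++ s2) s, 0 < size s1 <= k & zero_sum (map f s1)].
Proof.
move=> forced ns.
have [|| s1 [s2 [eqs sz z1]]] :=
  @short_zero_sum_forcedP n residues [::] (take n s) forced.
- exact: size_takel.
- by apply/allP=> x _; apply: reduce_residues.
exists s1, (s2 ++ drop n s); split=> //; rewrite cats0 in eqs.
by rewrite catA -[X in perm_eq _ X](cat_take_drop n) perm_cat2r.
Qed.
End Extract.

(** The invariant eta of C_3 x C_3 is at most 7. *)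
Lemma eta_Z3xZ3 : short_zero_sum_forced 3 7 residues [::].
Proof. by vm_compute. Qed.

(** The Davenport constant of C_3 x C_3 is at most 5. *)
Lemma davenport_Z3xZ3 : short_zero_sum_forced 5 5 residues [::].
Proof. by vm_compute. Qed.

(** Nine terms minus at most three leave at least six, one more than the Davenport
    constant, so that the second zero-sum subsequence cannot exhaust the remainder;
    its complement there is the third one. *)
Lemma zero_sum_split3 (T : eqType) (f : T -> nat * nat) (s : seq T) :
    8 < size s -> zero_sum (map f s) ->
  exists s1 s2 s3, [/\ perm_eq s (s1 ++ s2 ++ s3),
    [/\ 0 < size s1, 0 < size s2 & 0 < size s3] &
    [/\ zero_sum (map f s1), zero_sum (map f s2) & zero_sum (map f s3)]].
Proof.
move=> s9 s0.
have [|s1 [r [eqs /andP[s1_gt0 s1_le3] z1]]] :=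
  extract_short_zero_sum f (s := s) eta_Z3xZ3; first exact: leq_trans s9.
have zr: zero_sum (map f r).
  by rewrite -(zero_sum_cat _ z1) -map_cat (zero_sum_perm (perm_map f eqs)).
have szr: 5 < size r.
  have := perm_size eqs; rewrite size_cat => sz.
  by rewrite -(ltn_add2l (size s1)) sz (leq_ltn_trans _ s9) // (leq_add s1_le3 (leqnn 5)).
have [|s2 [s3 [eqr /andP[s2_gt0 s2_le5] z2]]] :=
  extract_short_zero_sum f (s := r) davenport_Z3xZ3; first exact: ltnW.
have eqs123: perm_eq s (s1 ++ s2 ++ s3).
  by rewrite perm_sym (perm_trans _ eqs) // perm_cat2l.
have z3: zero_sum (map f s3).
  by rewrite -(zero_sum_cat _ z2) -map_cat (zero_sum_perm (perm_map f eqr)).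
have s3_gt0: 0 < size s3.
  rewrite -(ltn_add2l (size s2)) addn0 -size_cat (perm_size eqr).
  exact: leq_ltn_trans szr.
by exists s1, s2, s3.
Qed.

Local Open Scope ring_scope.

(** * Linear spans and linear substitutions *)

(** Spans of arbitrary subsets are needed in spaces of infinite dimension. *)
Section LinSpan.
Variables (K : fieldType) (V : lmodType K) (S : V -> Prop).

Inductive lin_span : V -> Prop :=
| LinSpan0 : lin_span 0
| LinSpanD c x y : S x -> lin_span y -> lin_span (c *: x + y).

Lemma lin_span_add x y : lin_span x -> lin_span y -> lin_span (x + y).
Proof.
elim=> [|c z t Sz _ IH] sy; first by rewrite add0r.
by rewrite -addrA; apply: LinSpanD => //; apply: IH.
Qed.

Lemma lin_span_in x : S x -> lin_span x.
Proof.
by move=> Sx; rewrite -[x]scale1r -[_ *: x]addr0; apply: LinSpanD => //; left.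
Qed.

Lemma lin_span_scale c x : lin_span x -> lin_span (c *: x).
Proof.
elim=> [|b z t Sz _ IH]; first by rewrite scaler0; left.
by rewrite scalerDr scalerA; apply: LinSpanD.
Qed.

Lemma lin_span_sum (I : eqType) (r : seq I) (f : I -> V) :
  (forall i, i \in r -> lin_span (f i)) -> lin_span (\sum_(i <- r) f i).
Proof.
elim: r => [|i r IHr] fS; first by rewrite big_nil; left.
rewrite big_cons; apply: lin_span_add; first by apply: fS; rewrite mem_head.
by apply: IHr => j jr; apply: fS; rewrite inE jr orbT.
Qed.
End LinSpan.

Lemma lin_span_mul (K : fieldType) (A : algType K) (S1 S2 S : A -> Prop) x y :
    (forall x y, S1 x -> S2 y -> S (x * y)) ->
  lin_span S1 x -> lin_span S2 y -> lin_span S (x * y).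
Proof.
move=> S12 sx sy; elim: sx => [|c z t Sz _ IH]; first by rewrite mul0r; left.
rewrite mulrDl; apply: lin_span_add => //; rewrite -scalerAl.
apply: lin_span_scale; elim: sy => [|b u v Su _ IHu]; first by rewrite mulr0; left.
by rewrite mulrDr -scalerAr; apply: LinSpanD => //; apply: S12.
Qed.

(** Ring morphisms out of a polynomial ring agree as soon as they agree on the
    scalars and on the variables; scalars are included because the morphisms
    below may extend the base field. *)
Lemma mpoly_rmorph_eq (F : fieldType) n (R : comNzRingType)
    (f g : {rmorphism {mpoly F[n]} -> R}) :
  (forall c, f c%:MP = g c%:MP) -> (forall i, f 'X_i = g 'X_i) -> f =1 g.
Proof.
move=> fgC fgX p; rewrite [p]mpolyE !raddf_sum /=; apply: eq_bigr => m _.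
rewrite -mul_mpolyC !rmorphM /= fgC; congr (_ * _).
rewrite mpolyXE_id !rmorph_prod /=.
by apply: eq_bigr => i _; rewrite !rmorphXn /= fgX.
Qed.

Lemma mpolyC_homog (K : fieldType) n (c : K) : (c%:MP : {mpoly K[n]}) \is 0.-homog.
Proof. by rewrite -[c%:MP]mulr1 mul_mpolyC rpredZ // dhomog1. Qed.

Lemma rmorph_homog (F K : fieldType) n k
    (f : {rmorphism {mpoly F[n]} -> {mpoly K[k]}}) d p :
    (forall c, f c%:MP \is 0.-homog) -> (forall i, f 'X_i \is 1.-homog) ->
  p \is d.-homog -> f p \is d.-homog.
Proof.
move=> fC fX hp; rewrite [p]mpolyE raddf_sum /= big_seq.
apply: rpred_sum => m mp; rewrite -mul_mpolyC rmorphM /= -[d]add0n.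
apply: dhomogM; first exact: fC.
have -> : d = mdeg m by rewrite -(dhomog_mf hp mp).
rewrite mpolyXE_id rmorph_prod /= mdegE.
apply: (big_ind2 (fun (x : {mpoly K[k]}) (e : nat) => x \is e.-homog)).
- exact: dhomog1.
- by move=> x1 d1 x2 d2; apply: dhomogM.
by move=> i _; rewrite rmorphXn /= -[X in X.-homog]mul1n; apply: dhomogMn.
Qed.

Section LinearSubstitution.
Variables (K : fieldType) (n : nat).
Implicit Types (M N : 'M[K]_n) (p q : {mpoly K[n]}).

(** The same formula as in [sym_act], for a single matrix: the substitution makes
    sense before any group is given, and it can be transported along a field
    extension. *)
Definition lin_subst M : {mpoly K[n]} -> {mpoly K[n]} :=
  comp_mpoly [tuple \sum_(j < n) M i j *: 'X_j | i < n].

HB.instance Definition _ M := GRing.LRMorphism.on (lin_subst M).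

Lemma lin_substX M i : lin_subst M 'X_i = \sum_j M i j *: 'X_j.
Proof. by rewrite /lin_subst comp_mpolyXU -tnth_nth tnth_mktuple. Qed.

Lemma lin_substC M c : lin_subst M c%:MP = c%:MP.
Proof. exact: comp_mpolyC. Qed.

Lemma lin_subst_homog M d p : p \is d.-homog -> lin_subst M p \is d.-homog.
Proof.
apply: rmorph_homog => [c|i] /=; first by rewrite lin_substC mpolyC_homog.
rewrite lin_substX; apply: rpred_sum => j _.
by rewrite rpredZ // dhomogX; apply/eqP/mdeg1.
Qed.

Lemma lin_subst_comp M N p : lin_subst N (lin_subst M p) = lin_subst (M *m N) p.
Proof.
apply: (mpoly_rmorph_eq (f := lin_subst N \o lin_subst M)) => [c|i] /=.
  by rewrite !lin_substC.
rewrite !lin_substX linear_sum /=.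
under eq_bigr do rewrite linearZ /= lin_substX scaler_sumr.
rewrite exchange_big; apply: eq_bigr => j _ /=.
by rewrite mxE scaler_suml; apply: eq_bigr => k _; rewrite scalerA.
Qed.

Lemma lin_subst1 p : lin_subst 1%:M p = p.
Proof.
apply: (mpoly_rmorph_eq (g := idfun)) => [c|i] /=; first exact: lin_substC.
rewrite lin_substX.
rewrite (bigD1 i) //= mxE eqxx scale1r big1 ?addr0 // => j ji.
by rewrite mxE eq_sym (negPf ji) scale0r.
Qed.
End LinearSubstitution.

Lemma lin_subst_map (F K : fieldType) (iota : {rmorphism F -> K}) n
    (M : 'M[F]_n) (p : {mpoly F[n]}) :
  map_mpoly iota (lin_subst M p) = lin_subst (map_mx iota M) (map_mpoly iota p).
Proof.
rewrite /lin_subst map_mpoly_comp; last exact: fmorph_inj.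
congr comp_mpoly; apply: eq_from_tnth => i; rewrite tnth_map !tnth_mktuple.
rewrite raddf_sum /=; apply: eq_bigr => j _.
by rewrite map_mpolyZ map_mpolyX mxE.
Qed.

(** * Operators of order three *)

Section OrderThree.
Variables (K : fieldType) (V : lmodType K) (f : {linear V -> V}).
Hypothesis three_neq0 : (3%:R : K) != 0.
Hypothesis f_order3 : forall x, f (f (f x)) = x.

Definition average3 (g : V -> V) (x : V) : V := 3%:R^-1 *: (x + g x + g (g x)).

Lemma average3_fixed x : f (average3 f x) = average3 f x.
Proof.
rewrite /average3 linearZ /= !(linearD f) /= f_order3; congr (_ *: _).
by rewrite addrC addrA.
Qed.

Lemma average3_id x : f x = x -> average3 f x = x.
Proof.
move=> fx; rewrite /average3 !fx -{1 2 3}[x]scale1r -!scalerDl scalerA.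
have -> : 1 + 1 + 1 = 3%:R :> K by ring.
by rewrite mulVf // scale1r.
Qed.

Variable w : K.
Hypothesis w_root : w ^+ 2 + w + 1 = 0.

Lemma cube_root_unity : w ^+ 3 = 1.
Proof.
apply/eqP; rewrite -subr_eq0; apply/eqP.
by transitivity ((w - 1) * (w ^+ 2 + w + 1)); [ring | rewrite w_root mulr0].
Qed.

Lemma cube_root_expr_mod a : w ^+ (a %% 3)%N = w ^+ a.
Proof. exact: expr_mod cube_root_unity. Qed.

(** The factor is the sum 1 + b + b^2 for a cube root of unity b, which vanishes
    unless b is 1. *)
Lemma average3_eigen a x :
  f x = w ^+ a *: x -> average3 f x = if (3 %| a)%N then x else 0.
Proof.
rewrite /average3 /dvdn -cube_root_expr_mod => fx; rewrite !(fx, linearZ) /=.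
have a3 : (a %% 3 < 3)%N by rewrite ltn_mod.
have expand (b : K) : x + b *: x + b *: (b *: x) = (b ^+ 2 + b + 1) *: x.
  by rewrite scalerA -{1}[x]scale1r -!scalerDl; congr (_ *: _); ring.
rewrite expand; case: (a %% 3)%N a3 => [|[|[|]]] //= _.
- rewrite scalerA expr0; have -> : 1 ^+ 2 + 1 + 1 = 3%:R :> K by ring.
  by rewrite mulVf // scale1r.
- by rewrite w_root scale0r scaler0.
have -> : (w ^+ 2) ^+ 2 + w ^+ 2 + 1 = (w ^+ 2 + w + 1) * (w ^+ 2 - w + 1) by ring.
by rewrite w_root mul0r scale0r scaler0.
Qed.

(** The Fourier component of [x] on the eigenspace of [w ^+ a].  The inverse of
    [w ^+ a] is written [w ^+ (2 * a)]. *)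
Definition eigen_part (a : nat) (x : V) : V :=
  3%:R^-1 *: (x + w ^+ (2 * a) *: f x + w ^+ a *: f (f x)).

Lemma eigen_partP a x : f (eigen_part a x) = w ^+ a *: eigen_part a x.
Proof.
have fZ c y : f (c *: y) = c *: f y by rewrite linearZ.
rewrite /eigen_part fZ !(linearD f) /= !fZ f_order3.
rewrite scalerA mulrC -scalerA; congr (_ *: _).
rewrite !scalerDr !scalerA -!exprD addnn -mul2n -mulSn.
by rewrite (exprM _ 3) cube_root_unity expr1n scale1r addrC addrA.
Qed.

Lemma eigen_part_sum x : \sum_(a < 3) eigen_part a x = x.
Proof.
rewrite !big_ord_recr big_ord0 /= add0r /eigen_part -!scalerDr /= !muln0 !muln1.
rewrite !expr0 !scale1r expr1.
have -> : w ^+ (2 * 2) = w by rewrite -cube_root_expr_mod expr1.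
rewrite (AC (3 * 3 * 3) ((1 * 4 * 7) * (2 * 5 * 8) * (3 * 6 * 9))) /=.
rewrite -[X in _ + (X + _ *: _ + _) + _]scale1r -[X in _ + _ + (X + _ *: _ + _)]scale1r.
rewrite -!scalerDl.
have -> : 1 + w ^+ 2 + w = 0 by rewrite -w_root; ring.
have -> : 1 + w + w ^+ 2 = 0 by rewrite -w_root; ring.
rewrite !scale0r !addr0 -[x in x + _ + _]scale1r.
have -> : 1 *: x + x + x = 3%:R *: x by rewrite scale1r scaler_nat mulrS mulr2n addrA.
by rewrite scalerA mulVf // scale1r.
Qed.
End OrderThree.

Lemma average3_linear (K : fieldType) (V : lmodType K) (f : {linear V -> V}) c x y :
  average3 f (c *: x + y) = c *: average3 f x + average3 f y.
Proof.
rewrite /average3 !linearP /= scalerA mulrC -scalerA -scalerDr; congr (_ *: _).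
by rewrite !scalerDr (AC ((2 * 2) * 2) ((1 * 3 * 5) * (2 * 4 * 6))).
Qed.

Section Commuting.
Variables (K : fieldType) (V : lmodType K) (f g : {linear V -> V}).

Lemma average3_commute x :
  (forall y, f (g y) = g (f y)) -> average3 f (g x) = g (average3 f x).
Proof. by move=> fg; rewrite /average3 !fg [RHS]linearZ /= !(linearD g). Qed.

Lemma eigen_partZ w a c x : eigen_part f w a (c *: x) = c *: eigen_part f w a x.
Proof.
have fZ b y : f (b *: y) = b *: f y by rewrite linearZ.
rewrite /eigen_part !fZ [RHS]scalerA [c * _]mulrC -[RHS]scalerA; congr (_ *: _).
by rewrite !scalerDr !scalerA ![c * _]mulrC.
Qed.

Lemma eigen_part_commute w a x :
  (forall y, f (g y) = g (f y)) -> eigen_part f w a (g x) = g (eigen_part f w a x).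
Proof.
have gZ b y : g (b *: y) = b *: g y by rewrite linearZ.
by move=> fg; rewrite /eigen_part !fg gZ !(linearD g) /= !gZ.
Qed.
End Commuting.

(** * Invariants of the abelian subgroup over a field with cube roots of unity *)

Section AbelianInvariants.
Variables (K : fieldType) (n : nat) (A C : 'M[K]_n).
Implicit Types (p q u v : {mpoly K[n]}).

Definition fixed_form d u :=
  [/\ u \is d.-homog, lin_subst A u = u & lin_subst C u = u].

(** A homogeneous generator of degree [d] of the cube of the ideal of invariants
    of positive degree. *)
Definition triple_product d p :=
  exists i j k u v w, [/\ [/\ 0 < i, 0 < j & 0 < k]%N, d = (i + j + k)%N,
    [/\ fixed_form i u, fixed_form j v & fixed_form k w] & p = u * v * w].

Hypothesis three_neq0 : (3%:R : K) != 0.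
Hypotheses (A_order3 : A *m A *m A = 1%:M) (C_order3 : C *m C *m C = 1%:M).
Hypothesis AC_comm : A *m C = C *m A.

Let A3 p : lin_subst A (lin_subst A (lin_subst A p)) = p.
Proof. by rewrite !lin_subst_comp mulmxA A_order3 lin_subst1. Qed.

Let C3 p : lin_subst C (lin_subst C (lin_subst C p)) = p.
Proof. by rewrite !lin_subst_comp mulmxA C_order3 lin_subst1. Qed.

Let CA p : lin_subst C (lin_subst A p) = lin_subst A (lin_subst C p).
Proof. by rewrite !lin_subst_comp AC_comm. Qed.

Definition average33 p := average3 (lin_subst C) (average3 (lin_subst A) p).

Lemma average33_linear c p q :
  average33 (c *: p + q) = c *: average33 p + average33 q.
Proof.
rewrite /average33 -(average3_linear (lin_subst C)); congr average3.
exact: (average3_linear (lin_subst A)).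
Qed.

Lemma average3_homog M d p : p \is d.-homog -> average3 (lin_subst M) p \is d.-homog.
Proof. by move=> hp; rewrite rpredZ // !rpredD // !lin_subst_homog. Qed.

Lemma average33_fixed d p : p \is d.-homog -> fixed_form d (average33 p).
Proof.
move=> hp; split; first by rewrite !average3_homog.
  set q := average3 (lin_subst A) p.
  have Aq : lin_subst A q = q by apply: average3_fixed.
  transitivity (average3 (lin_subst C) (lin_subst A q)).
    by symmetry; apply: average3_commute; apply: CA.
  exact: (congr1 (average3 (lin_subst C)) Aq).
exact: average3_fixed.
Qed.

Lemma average33_id p : lin_subst A p = p -> lin_subst C p = p -> average33 p = p.
Proof. by move=> Ap Cp; rewrite /average33 !average3_id. Qed.

Variable w : K.
Hypothesis w_root : w ^+ 2 + w + 1 = 0.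

Definition eigenform (x : (nat * nat) * {mpoly K[n]}) :=
  [/\ x.2 \is 1.-homog, lin_subst A x.2 = w ^+ x.1.1 *: x.2 &
      lin_subst C x.2 = w ^+ x.1.2 *: x.2].

Definition eigen_product d p :=
  exists l : seq ((nat * nat) * {mpoly K[n]}),
    [/\ size l = d, {in l, forall x, eigenform x} & p = \prod_(x <- l) x.2].

Lemma eigen_product_mul d e p q :
  eigen_product d p -> eigen_product e q -> eigen_product (d + e) (p * q).
Proof.
move=> [l [<- hl ->]] [l' [<- hl' ->]]; exists (l ++ l'); split.
- exact: size_cat.
- by move=> x; rewrite mem_cat => /orP[/hl | /hl'].
- by rewrite big_cat.
Qed.

(** Taking Fourier components for one operator and then for the other gives
    simultaneous eigenvectors, since the operators commute. *)
Lemma eigen_product_span1 i : lin_span (eigen_product 1) 'X_i.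
Proof.
pose fA : {linear _ -> _} := lin_subst A; pose fC : {linear _ -> _} := lin_subst C.
pose qA (a : nat) : {mpoly K[n]} := eigen_part fA w a 'X_i.
have hom1 M (a : nat) p : p \is 1.-homog -> eigen_part (lin_subst M) w a p \is 1.-homog.
  by move=> hp; rewrite rpredZ // !rpredD // rpredZ // !lin_subst_homog.
have hX : ('X_i : {mpoly K[n]}) \is 1.-homog by rewrite dhomogX; apply/eqP/mdeg1.
rewrite -(eigen_part_sum fA three_neq0 w_root 'X_i).
apply: lin_span_sum => a _.
rewrite -[eigen_part _ _ _ _](eigen_part_sum fC three_neq0 w_root).
apply: lin_span_sum => b _; apply: lin_span_in.
exists [:: ((a : nat, b : nat), eigen_part fC w b (qA a))].
split=> //; last by rewrite big_seq1.
move=> x; rewrite inE => /eqP -> /=; split; first by rewrite !hom1.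
  have qAP : lin_subst A (qA a) = w ^+ a *: qA a by apply: eigen_partP.
  transitivity (eigen_part fC w b (lin_subst A (qA a))).
    exact/esym/eigen_part_commute/CA.
  rewrite qAP; exact: eigen_partZ.
exact: eigen_partP.
Qed.

Lemma eigen_product_span d p : p \is d.-homog -> lin_span (eigen_product d) p.
Proof.
move=> hp; rewrite [p]mpolyE; apply: lin_span_sum => m /(dhomog_mf hp) /= <-.
apply: lin_span_scale; rewrite mpolyXE_id mdegE.
apply: (big_ind2 (fun (x : {mpoly K[n]}) (d : nat) => lin_span (eigen_product d) x)).
- by apply: lin_span_in; exists [::]; rewrite big_nil.
- by move=> x1 d1 x2 d2; apply: lin_span_mul; apply: eigen_product_mul.
move=> i _; elim: (m i) => [|k IHk].
  by rewrite expr0; apply: lin_span_in; exists [::]; rewrite big_nil.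
rewrite exprS -add1n; apply: lin_span_mul (eigen_product_span1 i) IHk.
exact: eigen_product_mul.
Qed.

Lemma eigen_prodP (l : seq ((nat * nat) * {mpoly K[n]})) :
    {in l, forall x, eigenform x} ->
  [/\ \prod_(x <- l) x.2 \is (size l).-homog,
      lin_subst A (\prod_(x <- l) x.2) =
        w ^+ sumn (unzip1 (map fst l)) *: \prod_(x <- l) x.2 &
      lin_subst C (\prod_(x <- l) x.2) =
        w ^+ sumn (unzip2 (map fst l)) *: \prod_(x <- l) x.2].
Proof.
elim: l => [|x l IHl] hl.
  by rewrite big_nil !rmorph1 !expr0 !scale1r; split=> //; apply: dhomog1.
have [hx Ax Cx] := hl x (mem_head x l).
have [|hl' Al Cl] := IHl; first by move=> y yl; apply: hl; rewrite inE yl orbT.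
rewrite big_cons !rmorphM /= Ax Cx Al Cl !exprD -!scalerAl -!scalerAr !scalerA.
by split=> //; rewrite -add1n; apply: dhomogM.
Qed.

Lemma average33_eigen_prod (l : seq ((nat * nat) * {mpoly K[n]})) :
    {in l, forall x, eigenform x} ->
  average33 (\prod_(x <- l) x.2) =
    if zero_sum (map fst l) then \prod_(x <- l) x.2 else 0.
Proof.
move=> /eigen_prodP[_ Al Cl]; rewrite /average33 /zero_sum.
rewrite (average3_eigen three_neq0 w_root Al).
case: ifP => _ /=; first by rewrite (average3_eigen three_neq0 w_root Cl).
by rewrite /average3 !raddf0 !addr0 scaler0.
Qed.

(** An invariant equals its own average, and averaging a product of eigenvectors
    leaves it unchanged when its weights sum to zero and kills it otherwise.  Each
    surviving product has at least 9 factors, so its weights split into three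
    zero-sum sequences, and the three partial products are invariants. *)
Lemma fixed_triple_products d p :
  (8 < d)%N -> fixed_form d p -> lin_span (triple_product d) p.
Proof.
move=> d_gt8 [hp Ap Cp]; rewrite -(average33_id Ap Cp).
elim: (eigen_product_span hp) => [|c q t [l [szl hl ->]] _ IH].
  by rewrite /average33 /average3 !(raddf0, addr0, scaler0); left.
rewrite average33_linear; apply: lin_span_add => //; apply: lin_span_scale.
rewrite average33_eigen_prod //; case: ifP => [zl|_]; last by left.
have [|l1 [l2 [l3 [eql [l1_gt0 l2_gt0 l3_gt0] [z1 z2 z3]]]]] := zero_sum_split3 _ zl.
  by rewrite szl.
have fixed_prod l' : {subset l' <= l} -> zero_sum (map fst l') ->
    fixed_form (size l') (\prod_(x <- l') x.2).
  move=> l'l z'; have hl' : {in l', forall x, eigenform x} by move=> x /l'l/hl.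
  have [h' _ _] := eigen_prodP hl'.
  by move: (average33_fixed h'); rewrite average33_eigen_prod // z'.
apply: lin_span_in; exists (size l1), (size l2), (size l3).
exists (\prod_(x <- l1) x.2), (\prod_(x <- l2) x.2), (\prod_(x <- l3) x.2).
split=> //.
- by rewrite -szl (perm_size eql) !size_cat addnA.
- by split; apply: fixed_prod => // x xl; rewrite (perm_mem eql) !mem_cat xl ?orbT.
- by rewrite (perm_big _ eql) !big_cat /= mulrA.
Qed.
End AbelianInvariants.

(** * Descent to the base field *)

(** Either w exists in F already, or K is F[X]/(X^2 + X + 1).  The additive map
    [lambda] is an F-linear retraction of K onto F; it brings identities between
    polynomials over K back to F. *)
Lemma cube_root_extension (F : fieldType) :
  exists (K : fieldType) (iota : {rmorphism F -> K}) (lambda : {additive K -> F})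
         (w : K),
    [/\ w ^+ 2 + w + 1 = 0, forall a x, lambda (iota a * x) = a * lambda x
      & lambda 1 = 1].
Proof.
pose f : {poly F} := 'X^2 + 'X + 1.
have rootE (R : fieldType) (iota : {rmorphism F -> R}) (w : R) :
    root (map_poly iota f) w -> w ^+ 2 + w + 1 = 0.
  by rewrite /root !rmorphD /= rmorph1 map_polyXn map_polyX !hornerE => /eqP.
case: (classic (exists w, root f w)) => [[w fw] | no_root].
  exists F, idfun, idfun, w; split=> //.
  by apply: (rootE F idfun); rewrite map_poly_id.
have sizef : size f = 3%N.
  rewrite /f -addrA size_polyDl ?size_polyXn //.
  by rewrite (leq_ltn_trans (size_polyD _ _)) // size_polyX size_poly1.
have irr_f : irreducible_poly f.
  apply: cubic_irreducible; rewrite ?sizef // => w; apply/negP => fw.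
  by case: no_root; exists w.
have [L _ [w fw _]] := irredp_FAdjoin irr_f.
exists L, (in_alg L), (coord [tuple (1 : L)] ord0), w; split.
- exact: (rootE L (in_alg L)).
- by move=> a x; rewrite /= mulr_algl linearZ.
have free1 : free [tuple (1 : L)] by rewrite seq1_free oner_eq0.
by have := coord_free ord0 ord0 free1; rewrite eqxx.
Qed.

(** The matrices A and C are defined over F, so the K-space of invariants is
    spanned by invariants over F, namely the averages of the monomials; applying
    [lambda] to the coefficients therefore turns a K-combination of triple products
    into an F-combination. *)
Section Descent.
Variables (F K : fieldType) (iota : {rmorphism F -> K}) (lambda : {additive K -> F}).
Variables (n : nat) (A C : 'M[F]_n) (w : K).
Hypothesis three_neq0 : (3%:R : F) != 0.
Hypotheses (A_order3 : A *m A *m A = 1%:M) (C_order3 : C *m C *m C = 1%:M).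
Hypothesis AC_comm : A *m C = C *m A.
Hypothesis w_root : w ^+ 2 + w + 1 = 0.
Hypothesis lambdaM : forall a x, lambda (iota a * x) = a * lambda x.
Hypothesis lambda1 : lambda 1 = 1.

Let A' := map_mx iota A.
Let C' := map_mx iota C.
(* The polynomials over K obtained by extension of scalars from S. *)
Let im (S : {mpoly F[n]} -> Prop) (q : {mpoly K[n]}) := exists2 v, S v & q = map_mpoly iota v.

Lemma map_average3 M (p : {mpoly F[n]}) : map_mpoly iota (average3 (lin_subst M) p) =
  average3 (lin_subst (map_mx iota M)) (map_mpoly iota p).
Proof.
by rewrite /average3 map_mpolyZ fmorphV rmorph_nat !raddfD /= !lin_subst_map.
Qed.

Let three_neq0' : (3%:R : K) != 0.
Proof. by rewrite -(rmorph_nat iota) fmorph_eq0. Qed.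

Lemma fixed_form_span d u :
  fixed_form A' C' d u -> lin_span (im (fixed_form A C d)) u.
Proof.
move=> [hu Au Cu]; rewrite -(average33_id three_neq0' Au Cu).
have avg_sum (r : seq 'X_{1..n}) : average33 A' C' (\sum_(m <- r) u@_m *: 'X_[m]) =
    \sum_(m <- r) u@_m *: average33 A' C' 'X_[m].
  elim: r => [|m r IHr]; last by rewrite !big_cons average33_linear IHr.
  by rewrite !big_nil /average33 /average3 !(raddf0, addr0, scaler0).
rewrite [u in average33 _ _ u]mpolyE avg_sum; apply: lin_span_sum => m mu.
apply/lin_span_scale/lin_span_in; exists (average33 A C 'X_[m]).
  apply: average33_fixed => //; rewrite dhomogX.
  exact/eqP/(dhomog_mf hu).
by rewrite /average33 !map_average3 map_mpolyX.
Qed.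

Lemma triple_product_span d q :
  triple_product A' C' d q -> lin_span (im (triple_product A C d)) q.
Proof.
move=> [i [j [k [u [v [t [[i0 j0 k0] dE [hu hv ht] ->]]]]]]].
pose double x := exists u v,
  [/\ fixed_form A C i u, fixed_form A C j v & x = u * v].
apply: (lin_span_mul (S1 := im double) (S2 := im (fixed_form A C k))).
- move=> _ _ [_ [u1 [v1 [hu1 hv1 ->]]] ->] [t1 ht1 ->].
  by exists (u1 * v1 * t1); [exists i, j, k, u1, v1, t1 | rewrite !rmorphM].
- apply: (lin_span_mul (S1 := im (fixed_form A C i)) (S2 := im (fixed_form A C j))).
  + move=> _ _ [u1 hu1 ->] [v1 hv1 ->].
    by exists (u1 * v1); [exists u1, v1 | rewrite rmorphM].
  + exact: fixed_form_span.
  + exact: fixed_form_span.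
exact: fixed_form_span.
Qed.

Lemma map_lambda_span S q :
  lin_span (im S) q -> lin_span S (map_mpoly lambda q).
Proof.
elim=> [|c _ y [v Sv ->] _ IH]; first by rewrite raddf0; left.
have -> : map_mpoly lambda (c *: map_mpoly iota v + y) =
    lambda c *: v + map_mpoly lambda y.
  apply/mpolyP => m; rewrite mcoeffD mcoeffZ !mcoeff_map_mpoly mcoeffD mcoeffZ.
  by rewrite raddfD /= mcoeff_map_mpoly mulrC lambdaM mulrC.
exact: LinSpanD.
Qed.

Lemma fixed_triple_products_descent d p :
  (8 < d)%N -> fixed_form A C d p -> lin_span (triple_product A C d) p.
Proof.
move=> d_gt8 [hp Ap Cp].
have -> : p = map_mpoly lambda (map_mpoly iota p).
  apply/mpolyP => m; rewrite !mcoeff_map_mpoly.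
  by have := lambdaM p@_m 1; rewrite lambda1 !mulr1.
apply: map_lambda_span.
have hp' : fixed_form A' C' d (map_mpoly iota p).
  split; last by rewrite -lin_subst_map Cp.
    apply/dhomogP => m; rewrite (perm_mem (msupp_map_mpoly _ (fmorph_inj iota))).
    exact: dhomog_mf.
  by rewrite -lin_subst_map Ap.
have map_order3 (M : 'M[F]_n) : M *m M *m M = 1%:M ->
    map_mx iota M *m map_mx iota M *m map_mx iota M = 1%:M.
  by move=> M3; rewrite -!map_mxM M3 map_mx1.
have comm' : A' *m C' = C' *m A' by rewrite -!map_mxM AC_comm.
elim: (fixed_triple_products three_neq0' (map_order3 A A_order3)
  (map_order3 C C_order3) comm' w_root d_gt8 hp') => [|c q t hq _ IH]; first by left.
by apply: lin_span_add => //; apply/lin_span_scale/triple_product_span.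
Qed.
End Descent.

(** * From the abelian subgroup to the whole group *)

Section GeneratedAlgebra.
Variables (K : fieldType) (A : algType K) (S : A -> Prop).

Lemma generated_algZ c x : generated_alg S x -> generated_alg S (c *: x).
Proof. by move=> Sx; rewrite -[x]mul1r scalerAl; apply: GenMul => //; apply: GenScalar. Qed.

Lemma generated_alg0 : generated_alg S 0.
Proof. by rewrite -(scale0r 1); apply: GenScalar. Qed.

Lemma generated_alg_sum (I : Type) (r : seq I) (f : I -> A) :
  (forall i, generated_alg S (f i)) -> generated_alg S (\sum_(i <- r) f i).
Proof.
by move=> fS; apply: big_ind => //; [apply: generated_alg0 | apply: GenAdd].
Qed.
End GeneratedAlgebra.

Lemma generated_alg_mono (K : fieldType) (A : algType K) (S S' : A -> Prop) x :
  (forall y, S y -> S' y) -> generated_alg S x -> generated_alg S' x.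
Proof.
move=> SS'; elim=> [y /SS'|c|y z _ IHy _ IHz|y z _ IHy _ IHz].
- exact: GenIn.
- exact: GenScalar.
- exact: GenAdd.
- exact: GenMul.
Qed.

Lemma pihomog_lin_subst (K : fieldType) n (M : 'M[K]_n) d p :
  lin_subst M (pihomog mdeg d p) = pihomog mdeg d (lin_subst M p).
Proof.
pose k := maxn d.+1 (mmeasure mdeg p).
have dk : (d < k)%N by apply: leq_maxl.
have -> : lin_subst M p = \sum_(e < k) lin_subst M (pihomog mdeg e p).
  by rewrite {1}(pihomog_partitionE (leq_maxr d.+1 _ : (_ <= k)%N)); apply: raddf_sum.
rewrite [RHS](raddf_sum (pihomog mdeg d)) /=.
rewrite [RHS](bigD1 (Ordinal dk)) //= big1 => [|e e_neq].
  by rewrite addr0 [RHS]pihomog_dE //; apply/lin_subst_homog/pihomogP.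
by apply: pihomog_ne0 e_neq _; apply/lin_subst_homog/pihomogP.
Qed.

(** The matrices A, C and T stand for the images of a rotation, of a central element
    of order three and of a reflection. *)
Section Transfer.
Variables (F : fieldType) (n : nat) (A C T : 'M[F]_n).
Implicit Types (p q u v w : {mpoly F[n]}).
Hypothesis two_neq0 : (2%:R : F) != 0.
Hypothesis three_neq0 : (3%:R : F) != 0.
Hypotheses (A_order3 : A *m A *m A = 1%:M) (C_order3 : C *m C *m C = 1%:M).
Hypothesis (T_order2 : T *m T = 1%:M).
Hypothesis AC_comm : A *m C = C *m A.
Hypothesis TC_comm : T *m C = C *m T.
Hypothesis TA_dihedral : T *m A = A *m A *m T.

Local Notation t := (lin_subst T).

Definition full_invariant q := [/\ lin_subst A q = q, lin_subst C q = q & t q = q].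

Lemma tK q : t (t q) = q.
Proof. by rewrite lin_subst_comp T_order2 lin_subst1. Qed.

Lemma fixed_form_twist d u : fixed_form A C d u -> fixed_form A C d (t u).
Proof.
move=> [hu Au Cu]; split; first exact: lin_subst_homog.
  by rewrite lin_subst_comp TA_dihedral -!lin_subst_comp !Au.
by rewrite lin_subst_comp TC_comm -lin_subst_comp Cu.
Qed.

Lemma fixed_form_mul d e u v :
  fixed_form A C d u -> fixed_form A C e v -> fixed_form A C (d + e) (u * v).
Proof.
move=> [hu Au Cu] [hv Av Cv].
by split; [apply: dhomogM | rewrite rmorphM /= Au Av | rewrite rmorphM /= Cu Cv].
Qed.

Lemma fixed_formD d u v :
  fixed_form A C d u -> fixed_form A C d v -> fixed_form A C d (u + v).
Proof.
move=> [hu Au Cu] [hv Av Cv].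
by split; [apply: rpredD | rewrite raddfD /= Au Av | rewrite raddfD /= Cu Cv].
Qed.

Lemma fixed_formN d u : fixed_form A C d u -> fixed_form A C d (- u).
Proof.
move=> [hu Au Cu].
by split; [rewrite rpredN | rewrite raddfN /= Au | rewrite raddfN /= Cu].
Qed.

(** The sum over the choices of a symmetric or antisymmetric part in each factor
    with an even number of antisymmetric ones.  With a plus sign for every
    antisymmetric part, all eight choices sum to 8 u v w; with a minus sign, to
    8 t(u v w); half the sum of the two keeps the even choices. *)
Lemma transfer_triple u v w :
  4%:R *: (u * v * w + t (u * v * w)) =
    (u + t u) * ((v + t v) * (w + t w)) + (u + t u) * ((v - t v) * (w - t w)) +
    (v + t v) * ((u - t u) * (w - t w)) + (w + t w) * ((u - t u) * (v - t v)).
Proof. rewrite !rmorphM /= scaler_nat -mulr_natl; ring. Qed.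

Lemma four_neq0 : (4%:R : F) != 0.
Proof. by rewrite (natrM _ 2 2) mulf_neq0. Qed.

(** Every summand of [transfer_triple] is a product of G-invariants: the symmetric
    parts, and the products of two antisymmetric parts.  All of them have degree
    less than [d] because the three factors have positive degree. *)
Lemma generated_transfer (S : {mpoly F[n]} -> Prop) d q :
    (forall e r, (e < d)%N -> r \is e.-homog -> full_invariant r ->
      generated_alg S r) ->
  triple_product A C d q -> generated_alg S (q + t q).
Proof.
move=> lower [i [j [k [u [v [w [[i0 j0 k0] dE [hu hv hw] ->]]]]]]].
rewrite {d}dE in lower.
rewrite -[_ + _](scalerK four_neq0) transfer_triple.
apply: generated_algZ.
have even e x : (e < i + j + k)%N -> fixed_form A C e x -> generated_alg S (x + t x).
  move=> le_e hx; have [hom Ax Cx] := fixed_formD hx (fixed_form_twist hx).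
  by apply: lower le_e hom _; split=> //; rewrite raddfD /= tK addrC.
have product e1 e2 x y : (e1 + e2 < i + j + k)%N -> fixed_form A C e1 x ->
    fixed_form A C e2 y -> generated_alg S ((x - t x) * (y - t y)).
  move=> le_e hx hy; have odd_form e z : fixed_form A C e z -> fixed_form A C e (z - t z).
    by move=> hz; apply/fixed_formD/fixed_formN/fixed_form_twist.
  have [hom Axy Cxy] := fixed_form_mul (odd_form _ _ hx) (odd_form _ _ hy).
  apply: lower le_e hom _; split=> //.
  by rewrite rmorphM !raddfB /= !tK -mulrNN !opprB.
have lt_i : (i < i + j + k)%N by lia.
have lt_j : (j < i + j + k)%N by lia.
have lt_k : (k < i + j + k)%N by lia.
have lt_jk : (j + k < i + j + k)%N by lia.
have lt_ik : (i + k < i + j + k)%N by lia.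
have lt_ij : (i + j < i + j + k)%N by lia.
apply: GenAdd; first apply: GenAdd; first apply: GenAdd.
- by apply: GenMul; [apply: (even i) | apply: GenMul; [apply: (even j) | apply: (even k)]].
- by apply: GenMul; [apply: (even i) | apply: (product j k)].
- by apply: GenMul; [apply: (even j) | apply: (product i k)].
- by apply: GenMul; [apply: (even k) | apply: (product i j)].
Qed.

Definition small_invariant q :=
  full_invariant q /\ exists2 k, (k <= 8)%N & q \is k.-homog.

(** In degree at least 9 the invariant is the average of itself and its image under
    T, hence a combination of transfers of triple products. *)
Lemma homog_invariant_generated d p :
  p \is d.-homog -> full_invariant p -> generated_alg small_invariant p.
Proof.
elim/ltn_ind: d p => d IHd p hp inv_p.
have [d_le8 | d_gt8] := leqP d 8; first by apply: GenIn; split=> //; exists d.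
have [K [iota [lambda [w [w_root lambdaM lambda1]]]]] := cube_root_extension F.
have [Ap Cp tp] := inv_p.
have -> : p = 2%:R^-1 *: (p + t p).
  by rewrite tp -mulr2n -scaler_nat scalerK.
apply: generated_algZ.
have fix_p : fixed_form A C d p by split.
elim: (fixed_triple_products_descent three_neq0 A_order3 C_order3 AC_comm w_root
  lambdaM lambda1 d_gt8 fix_p) => [|c q r hq _ IH].
  by rewrite raddf0 addr0; apply: generated_alg0.
rewrite raddfD /= linearZ /= addrACA -scalerDr; apply: GenAdd IH.
apply/generated_algZ/(generated_transfer _ hq) => e x lt_e.
exact: IHd.
Qed.

Lemma invariant_generated p : full_invariant p -> generated_alg small_invariant p.
Proof.
move=> [Ap Cp tp]; rewrite (pihomog_partitionE (leqnn (mmeasure mdeg p))).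
apply: generated_alg_sum => d.
apply: (@homog_invariant_generated d); first exact: pihomogP.
by split; rewrite pihomog_lin_subst ?Ap ?Cp ?tp.
Qed.
End Transfer.

Lemma nat_least (P : nat -> Prop) N : P N ->
  exists2 b, P b /\ (forall d, P d -> (b <= d)%N) & (b <= N)%N.
Proof.
elim/ltn_ind: N => N IHN PN.
case: (classic (exists2 m, (m < N)%N & P m)) => [[m mN Pm] | minN].
  by have [b Pb bm] := IHN m mN Pm; exists b => //; apply: leq_trans bm (ltnW mN).
exists N => //; split=> // d Pd; rewrite leqNgt; apply/negP => dN.
by case: minN; exists d.
Qed.

(** * Generators and relations, and the upper bound *)

Local Notation gT := ('S_3 * 'Z_3)%type.

(** Points of 'I_3 are treated as elements of Z/3, on which S_3 acts as the group of
    affine maps; the third point is written -1 so that the ring laws apply. *)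
Lemma I3_cases (i : 'I_3) : [\/ i = 0, i = 1 | i = -1].
Proof.
by case: i => [[|[|[|//]]] lt_i];
  [apply: Or31 | apply: Or32 | apply: Or33]; apply: val_inj.
Qed.

Definition rotation : 'S_3 := perm (@addIr 'I_3 1).
Definition reflection : 'S_3 := perm (@oppr_inj 'I_3).


Definition gen_rot : gT := (rotation, 1%g).
Definition gen_refl : gT := (reflection, 1%g).
Definition gen_centr : gT := (1%g, 1%R : 'Z_3).

Lemma pair_ext (g h : gT) : g.1 = h.1 -> g.2 = h.2 -> g = h.
Proof. by case: g h => [x y] [x' y'] /= -> ->. Qed.

Lemma rotation3 : (rotation * rotation * rotation = 1)%g.
Proof.
apply/permP => i; rewrite !permM !permE.
by case: (I3_cases i) => ->; apply: val_inj.
Qed.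

Lemma rot_order3 : (gen_rot * gen_rot * gen_rot = 1)%g.
Proof. by apply: pair_ext; rewrite /= ?rotation3 ?mulg1. Qed.

Lemma centr_order3 : (gen_centr * gen_centr * gen_centr = 1)%g.
Proof. by apply: pair_ext; rewrite /= ?mulg1 //; apply: val_inj. Qed.

Lemma refl_order2 : (gen_refl * gen_refl = 1)%g.
Proof.
apply: pair_ext; rewrite /= ?mulg1 //.
by apply/permP => i; rewrite !permM !permE opprK.
Qed.

Lemma rot_centr : (gen_rot * gen_centr = gen_centr * gen_rot)%g.
Proof. by apply: pair_ext; rewrite /= mulg1 mul1g. Qed.

Lemma refl_centr : (gen_refl * gen_centr = gen_centr * gen_refl)%g.
Proof. by apply: pair_ext; rewrite /= mulg1 mul1g. Qed.

Lemma refl_rot : (gen_refl * gen_rot = gen_rot * gen_rot * gen_refl)%g.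
Proof.
apply: pair_ext; rewrite /= ?mulg1 //; apply/permP => i.
by rewrite !permM !permE; case: (I3_cases i) => ->; apply: val_inj.
Qed.

(** A permutation of Z/3 becomes one fixing 0 after composition with a power of the
    rotation, and a permutation fixing 0 is the identity or the reflection. *)
Lemma S3xZ3_ind (P : gT -> Prop) :
    P 1%g -> (forall g h, P g -> P h -> P (g * h)%g) ->
    P gen_rot -> P gen_refl -> P gen_centr ->
  forall g, P g.
Proof.
move=> P1 PM Prot Prefl Pcentr [s z].
have Ps0 (s' : 'S_3) : s' 0 = 0 -> P (s', 1%g).
  move=> s0; have inj_s := @perm_inj _ s'.
  have [s1|s1|s1] := I3_cases (s' 1); first by have := inj_s _ _ (etrans s1 (esym s0)).
    have [s2|s2|s2] := I3_cases (s' (-1)).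
    - by have := inj_s _ _ (etrans s2 (esym s0)).
    - by have := inj_s _ _ (etrans s2 (esym s1)).
    have -> : s' = 1%g by apply/permP => i; rewrite perm1; case: (I3_cases i) => ->.
    exact: P1.
  have [s2|s2|s2] := I3_cases (s' (-1)).
  - by have := inj_s _ _ (etrans s2 (esym s0)).
  - have -> // : s' = reflection.
    by apply/permP => i; rewrite permE; case: (I3_cases i) => ->; rewrite ?(s0, s1, s2) ?oppr0 ?opprK.
  - by have := inj_s _ _ (etrans s2 (esym s1)).
have Ps (s' : 'S_3) : P (s', 1%g).
  have [s0|s0|s0] := I3_cases (s' 0); first exact: Ps0.
    have -> : (s', 1%g) = ((s' * (rotation * rotation), 1) * gen_rot)%g :> gT.
      by apply: pair_ext; rewrite /= ?mulg1 // -mulgA rotation3 mulg1.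
    apply: (PM) => //; apply: Ps0; rewrite !permM s0 !permE; exact: val_inj.
  have -> : (s', 1%g) = ((s' * rotation, 1) * (gen_rot * gen_rot))%g :> gT.
    by apply: pair_ext; rewrite /= ?mulg1 // -mulgA (mulgA rotation) rotation3 mulg1.
  apply: (PM); last exact: (PM).
  by apply: Ps0; rewrite !permM s0 !permE; apply: val_inj.
have -> : (s, z) = ((s, 1) * (1, z))%g :> gT by apply: pair_ext; rewrite /= ?mulg1 ?mul1g.
apply: (PM) => //; have [->|->|->] := I3_cases z => //.
have -> // : (1%g, -1) = (gen_centr * gen_centr)%g :> gT.
  by apply: pair_ext; rewrite /= ?mulg1 //; apply: val_inj.
exact: PM.
Qed.

Section UpperBound.
Variables (F : fieldType).
Hypothesis two_neq0 : (2%:R : F) != 0.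
Hypothesis three_neq0 : (3%:R : F) != 0.

Lemma sym_actE (gT' : finGroupType) (G : {group gT'}) n
    (rG : mx_representation F G n) g : sym_act rG g = lin_subst (rG g).
Proof. by []. Qed.

Variables (n : nat) (rG : mx_representation F [set: gT] n).

Lemma invariant_full p :
  full_invariant (rG gen_rot) (rG gen_centr) (rG gen_refl) p -> Defs.invariant rG p.
Proof.
move=> [rp cp tp] g _; rewrite sym_actE; elim/S3xZ3_ind: g => //.
- by rewrite repr_mx1 lin_subst1.
- by move=> g h gp hp; rewrite repr_mxM ?inE // -lin_subst_comp gp.
Qed.

Lemma generated_in_degree_le8 : generated_in_degree_le rG 8.
Proof.
move=> p inv_p.
have rM g h : rG (g * h)%g = rG g *m rG h by rewrite repr_mxM ?inE.
have fixE g q : Defs.invariant rG q -> lin_subst (rG g) q = q.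
  by move/(_ g); rewrite inE sym_actE => ->.
have : generated_alg (small_invariant (rG gen_rot) (rG gen_centr) (rG gen_refl)) p.
  apply: invariant_generated => //.
  - by rewrite -!rM rot_order3 repr_mx1.
  - by rewrite -!rM centr_order3 repr_mx1.
  - by rewrite -!rM refl_order2 repr_mx1.
  - by rewrite -!rM rot_centr.
  - by rewrite -!rM refl_centr.
  - by rewrite -!rM refl_rot.
  - by split; apply: fixE.
by apply: generated_alg_mono => q [/invariant_full].
Qed.
End UpperBound.

Lemma beta_bounded_by8 (F : fieldType) : (2%:R : F) != 0 -> (3%:R : F) != 0 ->
  beta_bounded_by F [set: gT]%G 8.
Proof.
move=> two three n rG.
by have [b [gen_b min_b] b8] := nat_least (@generated_in_degree_le8 _ two three _ rG); exists b.
Qed.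

(** * An indecomposable invariant of degree eight *)

(** A monomial matrix acts on the coefficients of a polynomial by permuting them and
    rescaling them, which makes its invariants easy to read off. *)
Section Twist.
Variables (K : fieldType) (n : nat).
Implicit Types (d : 'I_n -> K) (s : 'S_n) (p : {mpoly K[n]}).

Definition monomial_subst d s p : {mpoly K[n]} :=
  comp_mpoly [tuple d i *: 'X_i | i < n] (msym s p).

HB.instance Definition _ d s := GRing.RMorphism.copy (monomial_subst d s)
  (comp_mpoly [tuple d i *: 'X_i | i < n] \o msym s).

Lemma monomial_substX d s i : monomial_subst d s 'X_i = d (s i) *: 'X_(s i).
Proof.
rewrite /monomial_subst; have -> : msym s 'X_i = 'X_(s i) :> {mpoly K[n]}.
  by rewrite /msym mmapX mmap1U.
by rewrite comp_mpolyXU -tnth_nth tnth_mktuple.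
Qed.

Lemma monomial_substZ d s c p : monomial_subst d s (c *: p) = c *: monomial_subst d s p.
Proof. by rewrite /monomial_subst msymZ comp_mpolyZ. Qed.

Lemma mcoeff_monomial_subst d s p m :
  (monomial_subst d s p)@_m =
    (\prod_i d i ^+ m i) * p@_[multinom m (s i) | i < n].
Proof.
rewrite -mcoeff_sym /monomial_subst; set q := msym s p.
elim/mpolyind: q => [|c m' q _ _ IHq]; first by rewrite comp_mpoly0 !mcoeff0 mulr0.
rewrite comp_mpolyD comp_mpolyZ !mcoeffD mulrDr IHq; congr (_ + _).
have -> : comp_mpoly [tuple d i *: 'X_i | i < n] 'X_[m'] =
    (\prod_i d i ^+ m' i) *: 'X_[m'] :> {mpoly K[n]}.
  rewrite comp_mpolyX [X in _ = _ *: X]mpolyXE_id -scaler_prod.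
  by apply: eq_bigr => i _; rewrite tnth_mktuple exprZn.
by rewrite !mcoeffZ mcoeffX mulrCA; case: eqP => [->|_]; rewrite ?mulr0.
Qed.
End Twist.

Section LowerBound.
Variables (K : fieldType) (w : K).
Hypothesis two_neq0 : (2%:R : K) != 0.
Hypothesis three_neq0 : (3%:R : K) != 0.
Hypothesis w_root : w ^+ 2 + w + 1 = 0.

Lemma cube_root_expr_eq1 e : w ^+ e = 1 -> (3 %| e)%N.
Proof.
rewrite -(cube_root_expr_mod w_root) /dvdn.
have : (e %% 3 < 3)%N by rewrite ltn_mod.
case: (e %% 3)%N => [|[|[|]]] //= _.
  rewrite expr1 => w1; case/eqP: three_neq0; rewrite -w_root w1; ring.
move=> w2; case/eqP: three_neq0.
have wE : w = - 2%:R.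
  by apply/eqP; rewrite -addr_eq0 -w_root w2; apply/eqP; ring.
by move: w2; rewrite wE => w2; transitivity ((- 2%:R) ^+ 2 - 1 : K); [ring | rewrite w2 subrr].
Qed.

Lemma I3_prod (R : comNzRingType) (f : 'I_3 -> R) :
  \prod_i f i = f 0 * f 1 * f (-1).
Proof.
rewrite !big_ord_recl big_ord0 mulr1 mulrA.
by congr (f _ * f _ * f _); apply: val_inj.
Qed.

(** The three variables x, y, z are ['X_0], ['X_1] and ['X_(-1)]. *)
Definition weights (a b c : K) (i : 'I_3) : K := nth 0 [:: a; b; c] i.

Definition rot_act : {mpoly K[3]} -> {mpoly K[3]} :=
  monomial_subst (weights w (w ^+ 2) 1) 1%g.
Definition centr_act : {mpoly K[3]} -> {mpoly K[3]} :=
  monomial_subst (weights w w (w ^+ 2)) 1%g.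
Definition refl_act : {mpoly K[3]} -> {mpoly K[3]} :=
  monomial_subst (weights 1 1 (-1)) (tperm 0 1).

Definition mnm3 a b c : 'X_{1..3} := [multinom nth 0%N [:: a; b; c] i | i < 3].

Lemma mnm3P (m : 'X_{1..3}) a b c :
  m 0 = a -> m 1 = b -> m (-1) = c -> m = mnm3 a b c.
Proof.
by move=> ma mb mc; apply/mnmP => i; rewrite mnmE; case: (I3_cases i) => ->.
Qed.

Lemma mcoeff_rot_act p m : (rot_act p)@_m = w ^+ (m 0%R + 2 * m 1%R)%N * p@_m.
Proof.
rewrite mcoeff_monomial_subst I3_prod /weights /= expr1n mulr1 [in RHS]exprD [in RHS]exprM.
by congr (_ * p@__); apply/mnmP => i; rewrite mnmE perm1.
Qed.

Lemma mcoeff_centr_act p m :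
  (centr_act p)@_m = w ^+ (m 0%R + m 1%R + 2 * m (-1)%R)%N * p@_m.
Proof.
rewrite mcoeff_monomial_subst I3_prod /weights /= 2![in RHS]exprD [in RHS]exprM.
by congr (_ * p@__); apply/mnmP => i; rewrite mnmE perm1.
Qed.

Lemma mcoeff_refl_act p a b c :
  (refl_act p)@_(mnm3 a b c) = (-1) ^+ c * p@_(mnm3 b a c).
Proof.
rewrite mcoeff_monomial_subst I3_prod /weights /= !expr1n !mul1r mnmE.
congr (_ * p@__); apply: mnm3P; rewrite mnmE.
- by rewrite tpermL mnmE.
- by rewrite tpermR mnmE.
- by rewrite tpermD // mnmE.
Qed.

Definition fixed3 p := [/\ rot_act p = p, centr_act p = p & refl_act p = p].

Lemma fixed3_support p m : fixed3 p -> p@_m != 0 ->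
  (3 %| m 0%R + 2 * m 1%R)%N /\ (3 %| m 0%R + m 1%R + 2 * m (-1)%R)%N.
Proof.
move=> [rp cp _] pm.
have eq1 e : w ^+ e * p@_m = p@_m -> (3 %| e)%N.
  by move=> we; apply: cube_root_expr_eq1; apply: (mulIf pm); rewrite mul1r.
by split; apply: eq1; rewrite -(mcoeff_rot_act, mcoeff_centr_act) ?rp ?cp.
Qed.

Lemma fixed3_swap p a b : fixed3 p -> p@_(mnm3 a b 1) = - p@_(mnm3 b a 1).
Proof. by move=> [_ _ rp]; rewrite -{1}rp mcoeff_refl_act expr1 mulN1r. Qed.

(** The reflection maps the monomial x^a y^a z to its opposite. *)
Lemma fixed3_diag p a : fixed3 p -> p@_(mnm3 a a 1) = 0.
Proof.
move=> fp; have /eqP := fixed3_swap a a fp.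
rewrite -addr_eq0 -mulr2n -mulr_natl mulf_eq0 (negPf two_neq0) /=.
by move/eqP.
Qed.

(** The divisors of x^5 y^2 z that are invariant under the abelian subgroup. *)
Lemma proper_factors a b c : (a <= 5)%N -> (b <= 2)%N -> (c <= 1)%N ->
    (3 %| a + 2 * b)%N -> (3 %| a + b + 2 * c)%N ->
  [\/ [/\ a = 0, b = 0 & c = 0], [/\ a = 3, b = 0 & c = 0],
      [/\ a = 2, b = 2 & c = 1] | [/\ a = 5, b = 2 & c = 1]]%N.
Proof.
move=> a5 b2 c1 d1 d2.
have [cE|cE] : c = 0%N \/ c = 1%N by lia.
  have bE : b = 0%N by lia.
  have [aE|aE] : a = 0%N \/ a = 3%N by lia.
    by constructor 1.
  by constructor 2.
have bE : b = 2%N by lia.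
have [aE|aE] : a = 2%N \/ a = 5%N by lia.
  by constructor 3.
by constructor 4.
Qed.

(** In the expansion of the coefficient of the product, each term vanishes: a
    monomial that is not invariant under the abelian subgroup has coefficient zero,
    and otherwise either one of the two monomials is x^5 y^2 z itself, or they are
    x^3 and x^2 y^2 z, where the coefficient at the latter is zero. *)
Lemma mcoeff521_mul p q : fixed3 p -> fixed3 q ->
  p@_(mnm3 5 2 1) = 0 -> q@_(mnm3 5 2 1) = 0 -> (p * q)@_(mnm3 5 2 1) = 0.
Proof.
move=> fp fq p0 q0; rewrite mcoeffM big1 //= => -[[m1 ?] [m2 ?]] /= /eqP m12.
have coord (i : 'I_3) : (nth 0 [:: 5; 2; 1] i = m1 i + m2 i)%N.
  by rewrite -mnmDE -m12 mnmE.
have m0 := coord 0; have m1' := coord 1; have mN := coord (-1).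
rewrite /= in m0 m1' mN.
have [-> | p1] := eqVneq (p@_m1) 0; first by rewrite mul0r.
have [d1 d2] := fixed3_support fp p1.
have le0 : (m1 0%R <= 5)%N by lia.
have le1 : (m1 1%R <= 2)%N by lia.
have leN : (m1 (-1)%R <= 1)%N by lia.
case: (proper_factors le0 le1 leN d1 d2) => [] [a0 b0 c0].
- have -> : m2 = mnm3 5 2 1 by apply: mnm3P; lia.
  by rewrite q0 mulr0.
- have -> : m2 = mnm3 2 2 1 by apply: mnm3P; lia.
  by rewrite (fixed3_diag _ fq) mulr0.
- by case/eqP: p1; rewrite (mnm3P a0 b0 c0) fixed3_diag.
by case/eqP: p1; rewrite (mnm3P a0 b0 c0).
Qed.

Lemma fixed3_mul p q : fixed3 p -> fixed3 q -> fixed3 (p * q).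
Proof.
by move=> [rp cp tp] [rq cq tq]; split; rewrite /rot_act /centr_act /refl_act rmorphM;
  congr (_ * _).
Qed.

Lemma fixed3_add p q : fixed3 p -> fixed3 q -> fixed3 (p + q).
Proof.
by move=> [rp cp tp] [rq cq tq]; split; rewrite /rot_act /centr_act /refl_act rmorphD;
  congr (_ + _).
Qed.

Lemma fixed3C c : fixed3 c%:MP.
Proof.
by split; rewrite -[c%:MP]mulr1 mul_mpolyC /rot_act /centr_act /refl_act
  monomial_substZ rmorph1.
Qed.

(** A homomorphism from Z/3 to the multiplicative group of K. *)
Definition exponential (i : 'I_3) : K := w ^+ i.
Local Notation e := exponential.

Lemma exponential_succ i : e (i + 1) = w * e i.
Proof.
rewrite /e; case: (I3_cases i) => ->; rewrite -exprS //=.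
by rewrite (cube_root_unity w_root).
Qed.

Lemma exponential_opp i : e (- i) = e i ^+ 2.
Proof.
by rewrite /e -exprM -[RHS](cube_root_expr_mod w_root); case: (I3_cases i) => ->.
Qed.

Definition linear3 a b c : {mpoly K[3]} := a *: 'X_0 + b *: 'X_1 + c *: 'X_(-1).

Lemma rot_act_linear3 a b c :
  rot_act (linear3 a b c) = linear3 (a * w) (b * w ^+ 2) c.
Proof.
rewrite /rot_act /linear3 !rmorphD /= !monomial_substZ !monomial_substX !perm1.
by rewrite /weights /= !scalerA mulr1.
Qed.

Lemma centr_act_linear3 a b c :
  centr_act (linear3 a b c) = linear3 (a * w) (b * w) (c * w ^+ 2).
Proof.
rewrite /centr_act /linear3 !rmorphD /= !monomial_substZ !monomial_substX !perm1.
by rewrite /weights /= !scalerA.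
Qed.

Lemma refl_act_linear3 a b c : refl_act (linear3 a b c) = linear3 b a (- c).
Proof.
rewrite /refl_act /linear3 !rmorphD /= !monomial_substZ !monomial_substX.
rewrite tpermL tpermR tpermD // /weights /= !scalerA !mulr1 mulrN1.
by rewrite (addrC (a *: _)).
Qed.

(** The image of the linear form x + y + z under the group element [h].  As 'S_3
    acts on Z/3 by affine maps, the permutation enters the coefficients of x and y
    only through the image of 0, and that of z only through its sign. *)
Definition orbit_form (h : gT) : {mpoly K[3]} :=
  linear3 (e h.2 * e (h.1 0)) (e h.2 * e (h.1 0) ^+ 2)
    ((-1) ^+ odd_perm h.1 * e h.2 ^+ 2).

Lemma odd_rotation : odd_perm rotation = false.
Proof.
have := congr1 (@odd_perm _) rotation3; rewrite !odd_permM odd_perm1.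
by case: odd_perm.
Qed.

Lemma odd_reflection : odd_perm reflection = true.
Proof.
have -> : reflection = tperm 1 (-1).
  apply/permP => i; rewrite permE; case: (I3_cases i) => ->.
  - by rewrite oppr0 tpermD.
  - by rewrite tpermL.
  - by rewrite opprK tpermR.
by rewrite odd_tperm.
Qed.

Lemma form_rot h : orbit_form (h * gen_rot)%g = rot_act (orbit_form h).
Proof.
rewrite rot_act_linear3 /orbit_form /= mulg1 permM permE exponential_succ.
rewrite odd_permM odd_rotation addbF.
by congr linear3; ring.
Qed.

Lemma form_centr h : orbit_form (h * gen_centr)%g = centr_act (orbit_form h).
Proof.
rewrite centr_act_linear3 /orbit_form /= mulg1.
have -> : e (h.2 * (1%R : 'Z_3))%g = w * e h.2 by apply: exponential_succ.
move: (e h.2) (e (h.1 0)) ((-1) ^+ _) => x y c.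
by congr linear3; ring.
Qed.

Lemma form_refl h : orbit_form (h * gen_refl)%g = refl_act (orbit_form h).
Proof.
rewrite refl_act_linear3 /orbit_form /= mulg1 permM permE odd_permM odd_reflection.
rewrite addbT signrN mulNr -exponential_opp opprK.
by rewrite exponential_opp.
Qed.
End LowerBound.

(** * Lower bound from the regular representation *)

Section RegularRepresentation.
Variables (F K : fieldType) (iota : {rmorphism F -> K}) (w : K).
Hypothesis two_neq0 : (2%:R : F) != 0.
Hypothesis three_neq0 : (3%:R : F) != 0.
Hypothesis w_root : w ^+ 2 + w + 1 = 0.

Local Notation G := [set: gT]%G.
Local Notation rG := (regular_repr F G).
Local Notation N := #|G|.

Let two_neq0' : (2%:R : K) != 0.
Proof. by rewrite -(rmorph_nat iota) fmorph_eq0. Qed.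
Let three_neq0' : (3%:R : K) != 0.
Proof. by rewrite -(rmorph_nat iota) fmorph_eq0. Qed.

Definition reg_var (g : gT) : {mpoly F[N]} := 'X_(gring_index G g).

(** The regular representation maps equivariantly to the space spanned by x, y, z by
    sending the basis vector indexed by a group element to the image of x + y + z
    under that element. *)
Definition eval_forms : {mpoly F[N]} -> {mpoly K[3]} :=
  comp_mpoly [tuple orbit_form w (enum_val i) | i < N] \o map_mpoly iota.

HB.instance Definition _ := GRing.RMorphism.on eval_forms.

Lemma eval_formsC c : eval_forms c%:MP = (iota c)%:MP.
Proof. by rewrite /eval_forms /= map_mpolyC comp_mpolyC. Qed.

Lemma eval_formsX i : eval_forms 'X_i = orbit_form w (enum_val i).
Proof.
by rewrite /eval_forms /= map_mpolyX comp_mpolyXU -tnth_nth tnth_mktuple.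
Qed.

Lemma eval_forms_reg_var g : eval_forms (reg_var g) = orbit_form w g.
Proof. by rewrite eval_formsX gring_indexK ?inE. Qed.

Lemma eval_forms_homog d q : q \is d.-homog -> eval_forms q \is d.-homog.
Proof.
apply: rmorph_homog => [c|i] /=; first by rewrite eval_formsC mpolyC_homog.
rewrite eval_formsX /orbit_form /linear3.
by rewrite !rpredD // rpredZ // dhomogX; apply/eqP/mdeg1.
Qed.

Lemma regular_act_var g i :
  sym_act rG g 'X_i = reg_var (enum_val i * g)%g.
Proof.
rewrite sym_actE lin_substX (bigD1 (gring_index G (enum_val i * g)%g)) //= big1.
  by rewrite !mxE eqxx eqxx scale1r addr0.
by move=> j ji; rewrite !mxE (negPf ji) andbF scale0r.
Qed.

Lemma eval_forms_act g (act : {rmorphism {mpoly K[3]} -> {mpoly K[3]}}) :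
    (forall c, act c%:MP = c%:MP) ->
    (forall h, orbit_form w (h * g)%g = act (orbit_form w h)) ->
  forall q, eval_forms (sym_act rG g q) = act (eval_forms q).
Proof.
move=> actC actX q.
apply: (mpoly_rmorph_eq (f := eval_forms \o lin_subst (rG g)) (g := act \o eval_forms)).
  by move=> c /=; rewrite lin_substC eval_formsC actC.
move=> i; rewrite /= -sym_actE regular_act_var eval_forms_reg_var actX.
by rewrite eval_formsX.
Qed.

Lemma eval_forms_rot q :
  eval_forms (sym_act rG gen_rot q) = rot_act w (eval_forms q).
Proof.
apply: (eval_forms_act (act := monomial_subst _ _)) => [c|h].
  by have [] := fixed3C w c.
exact: form_rot.
Qed.

Lemma eval_forms_centr q :
  eval_forms (sym_act rG gen_centr q) = centr_act w (eval_forms q).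
Proof.
apply: (eval_forms_act (act := monomial_subst _ _)) => [c|h].
  by have [] := fixed3C w c.
exact: form_centr.
Qed.

Lemma eval_forms_refl q :
  eval_forms (sym_act rG gen_refl q) = refl_act (eval_forms q).
Proof.
apply: (eval_forms_act (act := monomial_subst _ _)) => [c|h].
  by have [] := fixed3C w c.
exact: form_refl.
Qed.

Lemma eval_forms_fixed q : Defs.invariant rG q -> fixed3 w (eval_forms q).
Proof.
move=> inv_q; split.
- by rewrite -eval_forms_rot inv_q ?inE.
- by rewrite -eval_forms_centr inv_q ?inE.
- by rewrite -eval_forms_refl inv_q ?inE.
Qed.

(** Generators of degree less than 8 have no term in x^5 y^2 z, and
    [mcoeff521_mul] shows that products do not create one. *)
Lemma generated_mcoeff521 d q : (d < 8)%N ->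
    generated_alg
      (fun q => Defs.invariant rG q /\ exists2 k, (k <= d)%N & q \is k.-homog) q ->
  fixed3 w (eval_forms q) /\ (eval_forms q)@_(mnm3 5 2 1) = 0.
Proof.
move=> d_lt8; elim=> [r [inv_r [k kd hr]]|c|x y _ [fx x0] _ [fy y0]|x y _ [fx x0] _ [fy y0]].
- split; first exact: eval_forms_fixed.
  apply: (dhomog_nemf_coeff (eval_forms_homog hr)).
  rewrite /= mdegE !big_ord_recl big_ord0 !mnmE /= eq_sym neq_ltn.
  by rewrite (leq_ltn_trans kd).
- rewrite -mul_mpolyC mulr1 eval_formsC; split; first exact: fixed3C.
  by rewrite mcoeffC; case: eqP => [/mnmP/(_ 0)|_]; rewrite ?mulr0 // !mnmE.
- by rewrite rmorphD mcoeffD x0 y0 addr0; split=> //; apply: fixed3_add.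
rewrite rmorphM; split; first exact: fixed3_mul.
exact: (mcoeff521_mul two_neq0' three_neq0' w_root fx fy x0 y0).
Qed.

(** A linear functional invariant under the group: the two monomials are fixed by the
    abelian subgroup, and the reflection exchanges them with a sign.  It therefore
    survives the summation over the group that turns a polynomial into an
    invariant. *)
Definition alternating_coeff (p : {mpoly K[3]}) : K :=
  p@_(mnm3 5 2 1) - p@_(mnm3 2 5 1).

Lemma alternating_coeffD p q :
  alternating_coeff (p + q) = alternating_coeff p + alternating_coeff q.
Proof. by rewrite /alternating_coeff !mcoeffD opprD addrACA. Qed.

Lemma alternating_coeff0 : alternating_coeff 0 = 0.
Proof. by rewrite /alternating_coeff !mcoeff0 subrr. Qed.

Lemma alternating_coeff_act g q :
  alternating_coeff (eval_forms (sym_act rG g q)) = alternating_coeff (eval_forms q).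
Proof.
have w9 k : w ^+ (3 * k) = 1 by rewrite exprM (cube_root_unity w_root) expr1n.
elim/S3xZ3_ind: g q => [q|g h gP hP q|q|q|q].
- by rewrite sym_actE repr_mx1 lin_subst1.
- have -> : sym_act rG (g * h)%g q = sym_act rG h (sym_act rG g q).
    by rewrite !sym_actE lin_subst_comp repr_mxM ?inE.
  rewrite hP; exact (gP q).
- rewrite eval_forms_rot /alternating_coeff !mcoeff_rot_act !mnmE /=.
  by rewrite (w9 3) (w9 4) !mul1r.
- rewrite eval_forms_refl /alternating_coeff !mcoeff_refl_act.
  by rewrite expr1 !mulN1r opprK addrC.
- rewrite eval_forms_centr /alternating_coeff !mcoeff_centr_act !mnmE /=.
  by rewrite (w9 3) !mul1r.
Qed.

(** The reflection fixes 0, so the two forms differ only by the sign of z, which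
    cancels. *)
Definition pair_var s k := reg_var (s, k) + reg_var ((reflection * s)%g, k).

Lemma eval_pair_var s k : eval_forms (pair_var s k) =
  linear3 (2%:R * (exponential w k * exponential w (s 0)))
          (2%:R * (exponential w k * exponential w (s 0) ^+ 2)) 0.
Proof.
rewrite rmorphD /= !eval_forms_reg_var /orbit_form /= permM permE oppr0.
rewrite odd_permM odd_reflection addTb signrN /linear3.
move: (exponential w k) (exponential w (s 0)) ((-1) ^+ _) => x y c.
rewrite (AC (3 * 3) ((1 * 4) * (2 * 5) * (3 * 6))) /= -!scalerDl.
by congr (_ *: _ + _ *: _ + _ *: _); ring.
Qed.

(** Multiples of x, y and z are hit by combinations with coefficients in F: the
    rotated pairs are chosen so that one of the two remaining coordinates agrees
    with that of the pair at the identity. *)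
Definition x_form := pair_var 1%g 0 - pair_var rotation 1.
Definition y_form := pair_var 1%g 0 - pair_var rotation (-1).
Definition z_form := reg_var (1%g, 0) - reg_var (reflection, 0).

Lemma eval_x_form : eval_forms x_form = (2%:R * (1 - w ^+ 2)) *: 'X_0.
Proof.
rewrite rmorphB /= !eval_pair_var perm1 permE /exponential /= !expr1 /linear3.
rewrite !scale0r !addr0 opprD addrACA -!scalerBl.
have -> : 2%:R * (1 * 1) - 2%:R * (w * w) = 2%:R * (1 - w ^+ 2) by ring.
have -> : 2%:R * (1 * 1 ^+ 2) - 2%:R * (w * w ^+ 2) = 0.
  by rewrite -(exprS w 2) (cube_root_unity w_root); ring.
by rewrite scale0r addr0.
Qed.

Lemma eval_y_form : eval_forms y_form = (2%:R * (1 - w)) *: 'X_1.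
Proof.
rewrite rmorphB /= !eval_pair_var perm1 permE /exponential /= !expr1 /linear3.
rewrite !scale0r !addr0 opprD addrACA -!scalerBl.
have w4 : w ^+ 2 * w ^+ 2 = w.
  by rewrite -exprD (exprS w 3) (cube_root_unity w_root) mulr1.
have -> : 2%:R * (1 * 1) - 2%:R * (w ^+ 2 * w) = 0.
  by rewrite -(exprSr w 2) (cube_root_unity w_root); ring.
have -> : 2%:R * (1 * 1 ^+ 2) - 2%:R * (w ^+ 2 * w ^+ 2) = 2%:R * (1 - w).
  by rewrite w4; ring.
by rewrite scale0r add0r.
Qed.

Lemma eval_z_form : eval_forms z_form = 2%:R *: 'X_(-1).
Proof.
rewrite rmorphB /= !eval_forms_reg_var /orbit_form /= perm1 permE oppr0.
rewrite odd_perm1 odd_reflection /exponential /= /linear3 opprD addrACA subrr add0r.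
by rewrite -scalerBl; congr (_ *: _); ring.
Qed.

Definition octic := x_form ^+ 5 * y_form ^+ 2 * z_form.

Lemma alternating_coeff_octic : alternating_coeff (eval_forms octic) != 0.
Proof.
have scaleM (a b : K) (p q : {mpoly K[3]}) : (a *: p) * (b *: q) = (a * b) *: (p * q).
  by rewrite -scalerAl -scalerAr scalerA.
have -> : eval_forms octic =
    ((2%:R * (1 - w ^+ 2)) ^+ 5 * (2%:R * (1 - w)) ^+ 2 * 2%:R) *: 'X_[mnm3 5 2 1].
  rewrite /octic 2!rmorphM /= !rmorphXn /= eval_x_form eval_y_form eval_z_form.
  rewrite [in RHS]mpolyXE_id I3_prod !mnmE /= expr1 !exprZn.
  by rewrite !scaleM.
rewrite /alternating_coeff !mcoeffZ !mcoeffX eqxx mulr1.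
have -> : (mnm3 5 2 1 == mnm3 2 5 1) = false.
  by apply/eqP => /mnmP m_eq; have := m_eq 0; rewrite !mnmE.
rewrite mulr0 subr0.
(* The norm of 1 - w, so that both factors are nonzero outside characteristic 3. *)
have factor : (1 - w ^+ 2) * (1 - w) = 3%:R.
  have -> : (1 - w ^+ 2) * (1 - w) =
    (w ^+ 2 + w + 1) * (w - 2%:R) + 3%:R by ring.
  by rewrite w_root mul0r add0r.
have : (1 - w ^+ 2) * (1 - w) != 0 by rewrite factor.
rewrite mulf_eq0 negb_or => /andP[nz1 nz2].
by rewrite !mulf_neq0 ?expf_neq0 ?mulf_neq0.
Qed.

Lemma card_group_neq0 : (#|{: gT}|%:R : K) != 0.
Proof.
rewrite card_prod card_Sn card_ord.
have -> : (3`! * 3)%N = (2 * 3 * 3)%N by [].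
by rewrite !natrM !mulf_neq0.
Qed.

(** If the invariants were generated in degree less than 8, the functional
    [alternating_coeff] would vanish on all of them, but on the sum of the images of
    [octic] it takes the value 18 times a nonzero scalar. *)
Lemma regular_degree_lower_bound d : generated_in_degree_le rG d -> (8 <= d)%N.
Proof.
move=> gen_d; rewrite leqNgt; apply/negP => d_lt8.
pose q := \sum_(g : gT) sym_act rG g octic.
have inv_q : Defs.invariant rG q.
  move=> h _; rewrite /q sym_actE raddf_sum /= [RHS](reindex_inj (mulIg h)) /=.
  by apply: eq_bigr => g _; rewrite !sym_actE lin_subst_comp repr_mxM ?inE.
have [fq q0] := generated_mcoeff521 d_lt8 (gen_d q inv_q).
have q1 : alternating_coeff (eval_forms q) = 0.
  by rewrite /alternating_coeff q0 (fixed3_swap _ _ fq) q0 oppr0 subr0.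
have alt_sum : alternating_coeff (eval_forms q) =
    \sum_(g : gT) alternating_coeff (eval_forms octic).
  rewrite (raddf_sum eval_forms) (big_morph _ alternating_coeffD alternating_coeff0).
  by apply: eq_bigr => g _; apply: alternating_coeff_act.
move/eqP: q1; rewrite alt_sum sumr_const -mulr_natl mulf_eq0.
by rewrite (negPf card_group_neq0) (negPf alternating_coeff_octic).
Qed.

End RegularRepresentation.

Lemma pchar_natr_neq0 (F : fieldType) p :
  prime p -> p \notin [pchar F] -> (p%:R : F) != 0.
Proof. by move=> pp; rewrite inE pp. Qed.

Local Close Scope ring_scope.

Theorem proposition3p3 (F : fieldType)
    (char_not2 : 2 \notin [pchar F]%R) (char_not3 : 3 \notin [pchar F]%R) :
  is_noether_number F [set: ('S_3 * 'Z_3)%type]%G 8.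
Proof.
have two_neq0 := pchar_natr_neq0 (isT : prime 2) char_not2.
have three_neq0 := pchar_natr_neq0 (isT : prime 3) char_not3.
split; first exact: beta_bounded_by8.
move=> d bounded; have [b [gen_b _] b_le_d] := bounded _ (regular_repr F [set: gT]%G).
have [K [iota [_ [w [w_root _ _]]]]] := cube_root_extension F.
apply: leq_trans b_le_d.
exact: (regular_degree_lower_bound iota two_neq0 three_neq0 w_root).
Qed.
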